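(* Let $\phi$ be a sentential formula of first-order standpoint logic (FOSL). Then $\phi$ is satisfiable if and only if $\phi$ has a model with at most $|\phi|$ precisifications. That is, for sentential FOSL formulas $\phi$, satisfiability and $|\phi|$-satisfiability coincide.
   Context: Syntax of FOSL. A signature $\langle \mathcal P,\mathcal C,\mathcal S\rangle$ consists of predicate symbols $\mathcal P$ (each with an arity in $\mathbb N$, possibly $0$), constant symbols $\mathcal C$ and standpoint symbols $\mathcal S$; $\mathcal V$ is a set of variables; these sets are countably infinite and pairwise disjoint. Terms are constants and variables. Standpoint expressions are given by $e_1,e_2 ::= * \mid s \mid e_1\cup e_2\mid e_1\cap e_2\mid e_1\setminus e_2$ with $s\in\mathcal S$. Formulas are given by $\phi,\psi ::= P(t_1,\dots,t_k)\mid \neg\phi\mid\phi\wedge\psi\mid\forall x\,\phi\mid\Box_e\phi$, where $P$ is a $k$-ary predicate symbol, the $t_i$ are terms, $x$ is a variable and $e$ a standpoint expression. $\mathit{Sub}(\phi)$ is the set of all subformulas of $\phi$, and the size of $\phi$ is $|\phi| := |\mathit{Sub}(\phi)|$. Semantics. A first-order standpoint structure is $\mathfrak M=\langle\Delta,\Pi,\sigma,\gamma\rangle$ where $\Delta$ is a non-empty set (domain), $\Pi$ is a non-empty set (of precisifications), $\sigma:\mathcal S\to 2^\Pi$, and $\gamma$ maps each $\pi\in\Pi$ to an ordinary first-order structure over the domain $\Delta$ for $\mathcal P,\mathcal C$, such that every constant $a$ is interpreted by the same element in all $\gamma(\pi)$. The map $\sigma$ is extended to standpoint expressions by $\sigma(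 * )=\Pi$ and $\sigma(e_1\bowtie e_2)=\sigma(e_1)\bowtie\sigma(e_2)$ for $\bowtie\,\in\{\cup,\cap,\setminus\}$. For $\pi\in\Pi$ and a variable assignment $v:\mathcal V\to\Delta$: $\mathfrak M,\pi,v\models P(t_1,\dots,t_k)$ iff this atom holds in $\gamma(\pi)$ under $v$; $\neg,\wedge,\forall$ are interpreted as usual (with $\pi$ fixed, $\forall x$ ranging over $\Delta$); $\mathfrak M,\pi,v\models\Box_e\phi$ iff $\mathfrak M,\pi',v\models\phi$ for all $\pi'\in\sigma(e)$. Further, $\mathfrak M,\pi\models\phi$ iff $\mathfrak M,\pi,v\models\phi$ for all $v$, and $\mathfrak M\models\phi$ ($\mathfrak M$ is a model of $\phi$) iff $\mathfrak M,\pi\models\phi$ for all $\pi\in\Pi$. $\phi$ is satisfiable iff it has a model; for $n\in\mathbb N$, $\phi$ is $n$-satisfiable iff it has a model with $|\Pi|=n$. A FOSL formula $\phi$ is sentential iff for every subformula of $\phi$ of the form $\Box_e\psi$, all variables occurring in $\psi$ are bound by a quantifier (i.e. $\psi$ has no free variables). *)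

(* Defs.v *)
From HB Require Import structures.
From mathcomp Require Import all_boot finmap.
From mathcomp Require Import boolp classical_sets functions cardinality.

Set Implicit Arguments.
Unset Strict Implicit.
Unset Printing Implicit Defensive.

Local Open Scope classical_set_scope.
Local Open Scope card_scope.
Local Open Scope fset_scope.

(* The variables are bundled with the signature.  Pairwise disjointness of the
   four sets of symbols is automatic since they are distinct types. *)
Record signature := Signature {
  psym : Type;
  arity : psym -> nat;
  csym : Type;
  ssym : Type;
  var : eqType;
  psym_countable : [set: psym] #= [set: nat];
  csym_countable : [set: csym] #= [set: nat];
  ssym_countable : [set: ssym] #= [set: nat];
  var_countable : [set: var] #= [set: nat]
}.

Inductive term (Sg : signature) : Type :=
| TConst of csym Sg
| TVar of var Sg.

Inductive sexpr (Sg : signature) : Type :=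
| SStar
| SSym of ssym Sg
| SCup of sexpr Sg & sexpr Sg
| SCap of sexpr Sg & sexpr Sg
| SDiff of sexpr Sg & sexpr Sg.

Inductive formula (Sg : signature) : Type :=
| FAtom (P : psym Sg) of (arity P).-tuple (term Sg)
| FNot of formula Sg
| FAnd of formula Sg & formula Sg
| FAll of var Sg & formula Sg
| FBox of sexpr Sg & formula Sg.

(* Classical equality and choice, so that finite sets of formulas make sense. *)
HB.instance Definition _ (Sg : signature) := gen_eqMixin (formula Sg).
HB.instance Definition _ (Sg : signature) := gen_choiceMixin (formula Sg).

Fixpoint subf (Sg : signature) (phi : formula Sg) : {fset formula Sg} :=
  phi |` match phi with
         | FAtom _ _ => fset0
         | FNot psi => subf psi
         | FAnd psi chi => subf psi `|` subf chi
         | FAll _ psi => subf psi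
         | FBox _ psi => subf psi
         end.

(* Syntactically distinct subformulas are counted once each. *)
Definition fsize (Sg : signature) (phi : formula Sg) : nat := #|` subf phi|.

Fixpoint free_vars (Sg : signature) (phi : formula Sg) : set (var Sg) :=
  match phi with
  | FAtom _ ts => [set x | exists i, tnth ts i = TVar x]
  | FNot psi => free_vars psi
  | FAnd psi chi => (free_vars psi `|` free_vars chi)%classic
  | FAll x psi => (free_vars psi `\ x)%classic
  | FBox _ psi => free_vars psi
  end.

Definition sentential (Sg : signature) (phi : formula Sg) : Prop :=
  forall e psi, FBox e psi \in subf phi -> free_vars psi = set0.

Record fo_structure (Sg : signature) (D : Type) := FOStructure {
  pinterp : forall P : psym Sg, set ((arity P).-tuple D);
  cinterp : csym Sg -> D
}.

Record sp_structure (Sg : signature) := SPStructure {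
  dom : Type;
  prec : Type;
  sigma : ssym Sg -> set prec;
  gamma : prec -> fo_structure Sg dom;
  dom_nonempty : inhabited dom;
  prec_nonempty : inhabited prec;
  rigid : forall (a : csym Sg) (p q : prec),
    cinterp (gamma p) a = cinterp (gamma q) a
}.

Fixpoint sigma_ext (Sg : signature) (M : sp_structure Sg) (e : sexpr Sg) :
    set (prec M) :=
  match e with
  | SStar => setT
  | SSym s => sigma s
  | SCup e1 e2 => (sigma_ext e1 `|` sigma_ext e2)%classic
  | SCap e1 e2 => (sigma_ext e1 `&` sigma_ext e2)%classic
  | SDiff e1 e2 => (sigma_ext e1 `\` sigma_ext e2)%classic
  end.

Definition teval (Sg : signature) (D : Type) (I : fo_structure Sg D)
    (v : var Sg -> D) (t : term Sg) : D :=
  match t with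
  | TConst a => cinterp I a
  | TVar x => v x
  end.

Fixpoint sat_at (Sg : signature) (M : sp_structure Sg) (p : prec M)
    (v : var Sg -> dom M) (phi : formula Sg) : Prop :=
  match phi with
  | FAtom _ ts => pinterp (gamma p) (map_tuple (teval (gamma p) v) ts)
  | FNot psi => ~ sat_at p v psi
  | FAnd psi chi => sat_at p v psi /\ sat_at p v chi
  | FAll x psi => forall d : dom M, sat_at p [eta v with x |-> d] psi
  | FBox e psi => forall q : prec M, sigma_ext e q -> sat_at q v psi
  end.

Definition models (Sg : signature) (M : sp_structure Sg) (phi : formula Sg) :
    Prop :=
  forall (p : prec M) (v : var Sg -> dom M), sat_at p v phi.

Definition satisfiable (Sg : signature) (phi : formula Sg) : Prop :=
  exists M : sp_structure Sg, models M phi.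

Definition n_satisfiable (Sg : signature) (n : nat) (phi : formula Sg) : Prop :=
  exists M : sp_structure Sg, [set: prec M] #= `I_n /\ models M phi.

(* Main.v *)
Require Import Defs.
From mathcomp Require Import all_boot finmap.
From mathcomp Require Import boolp classical_sets functions cardinality.

Local Open Scope classical_set_scope.
Local Open Scope card_scope.

(** The truth value of a sentential box formula depends neither on the
    precisification nor on the assignment, so one counterexample per false box
    subformula suffices.  Choosing a precisification for every subformula, a
    counterexample where there is one, and pulling the model back along this
    choice preserves the truth of all subformulas.  Precisifications of the
    pulled-back model are indexed by the subformulas themselves, hence there are
    exactly as many of them as the size of the formula, repetitions in the choice
    being harmless. *)

Lemma subf_refl {Sg : signature} (phi : formula Sg) : phi \in subf phi.
Proof. by case: phi => *; rewrite /= !inE eqxx. Qed.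

Lemma sat_at_agree {Sg : signature} {M : sp_structure Sg} (phi : formula Sg)
    (p : prec M) (v w : var Sg -> dom M) :
  (forall x, free_vars phi x -> v x = w x) ->
  sat_at p v phi <-> sat_at p w phi.
Proof.
elim: phi p v w => [P ts|psi IH|psi IHp chi IHc|x psi IH|e psi IH] p v w vw /=.
- suff -> : map_tuple (teval (gamma p) v) ts = map_tuple (teval (gamma p) w) ts
    by [].
  apply: eq_from_tnth => i; rewrite !tnth_map.
  case Ets: (tnth ts i) => [a|x] //=.
  by apply: vw; exists i.
- by rewrite (IH p v w vw).
- rewrite (IHp p v w) ?(IHc p v w) // => x fx; apply: vw; [by right|by left].
- suff E d : sat_at p [eta v with x |-> d] psi
         <-> sat_at p [eta w with x |-> d] psi
    by split=> H d; apply/E/H.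
  apply: IH => y fy /=; case: eqVneq => // /eqP yx.
  by apply: vw; split.
- by split=> H q eq; apply/(IH q v w vw)/H.
Qed.

(** The domain is kept, so the same assignments serve both structures. *)
Definition pullback {Sg : signature} {M : sp_structure Sg} {Q : Type}
    (Q_nonempty : inhabited Q) (f : Q -> prec M) : sp_structure Sg :=
  @SPStructure Sg (dom M) Q (fun s => f @^-1` sigma s) (fun i => gamma (f i))
    (dom_nonempty M) Q_nonempty (fun a i j => rigid a (f i) (f j)).

(** Preimages commute with union, intersection and difference. *)
Lemma sigma_ext_pullback {Sg : signature} {M : sp_structure Sg} {Q : Type}
    (Q_nonempty : inhabited Q) (f : Q -> prec M) (e : sexpr Sg) :
  sigma_ext (M := pullback Q_nonempty f) e = f @^-1` sigma_ext e.
Proof. by elim: e => //= e1 -> e2 ->. Qed.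

(** Restricting to the range of [f] keeps true boxes true; a false box stays false because the
    hypothesis places a counterexample in that range, for the same assignment. *)
Lemma sat_at_pullback {Sg : signature} {M : sp_structure Sg} {Q : Type}
    (Q_nonempty : inhabited Q) (f : Q -> prec M) (phi : formula Sg) :
  (forall e psi q v, FBox e psi \in subf phi ->
     sigma_ext e q -> ~ sat_at q v psi ->
     exists2 i, sigma_ext e (f i) & ~ sat_at (f i) v psi) ->
  forall i v,
    sat_at (M := pullback Q_nonempty f) i v phi <-> sat_at (f i) v phi.
Proof.
elim: phi => [P ts|psi IH|psi IHp chi IHc|x psi IH|e psi IH] wit i v //=.
- rewrite IH // => e chi q w in_psi; apply: wit.
  by rewrite /= !inE in_psi orbT.
- rewrite IHp ?IHc // => e xi q w in_sub; apply: wit;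
    by rewrite /= !inE in_sub !orbT.
- have E d := IH _ i [eta v with x |-> d].
  split=> H d; apply/E/H => e chi q w in_psi; apply: wit;
    by rewrite /= !inE in_psi orbT.
- have E : forall j, sat_at (M := pullback Q_nonempty f) j v psi
                   <-> sat_at (f j) v psi.
    move=> j; apply: IH => e' chi q w in_psi; apply: wit.
    by rewrite /= !inE in_psi orbT.
  rewrite sigma_ext_pullback; split=> [H q eq|H j ej]; last exact/E/H.
  apply: contrapT => nsat.
  have [j ej] := wit e psi q v (subf_refl _) eq nsat.
  by apply; apply/E/H.
Qed.

(** Quantifying over the assignment lets the choice of a counterexample depend on the subformula
    alone. The set is empty unless [phi] is a box. *)
Definition refutes {Sg : signature} (M : sp_structure Sg) (phi : formula Sg) :
    set (prec M) :=
  [set q | exists e psi v,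
     [/\ phi = FBox e psi, sigma_ext e q & ~ sat_at q v psi]].

Lemma sentential_n_satisfiable {Sg : signature} (phi : formula Sg) :
  sentential phi -> satisfiable phi -> n_satisfiable (fsize phi) phi.
Proof.
move=> sent [M Mphi]; have [p0] := prec_nonempty M.
pose Q := set_type [set` subf phi].
have Q_nonempty : inhabited Q.
  by exists; exists phi; rewrite inE /= subf_refl.
have /choice[f fP] : forall chi : Q,
    exists p, refutes M (val chi) !=set0 -> refutes M (val chi) p.
  move=> chi; have [[q rq]|none] := pselect (refutes M (val chi) !=set0).
    by exists q.
  (* Nothing is to be refuted here, so any precisification will do. *)
  by exists p0.
exists (pullback Q_nonempty f); split.
  by apply: card_eq_trans (card_setT _) _; apply/card_eq_fsetP.
move=> i v; apply/sat_at_pullback; last exact: Mphi.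
move=> e psi q w box_in eq nsat.
have box_mem : FBox e psi \in [set` subf phi] by rewrite inE.
have [|e' [psi' [u [[<- <-] ef nsat_f]]]] := fP (SigSub box_mem).
  by exists q, e, psi, w.
exists (SigSub box_mem) => //.
(* The chosen counterexample comes with its own assignment [u]; as [psi] has no free variables, [u]
   may replace [w]. *)
by rewrite (@sat_at_agree _ _ _ _ w u) // => x; rewrite (sent _ _ box_in).
Qed.

Theorem theorem1 (Sg : signature) (phi : formula Sg)
  (phi_sentential : sentential phi) :
  (satisfiable phi <->
     exists M : sp_structure Sg,
       [set: prec M] #<= `I_(fsize phi) /\ models M phi) /\
  (satisfiable phi <-> n_satisfiable (fsize phi) phi).
Proof.
have sat_n := sentential_n_satisfiable phi phi_sentential.
split; split=> [|[M [_ Mphi]]]; [|by exists M|exact: sat_n|by exists M].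
by move=> /sat_n[M [+ Mphi]]; rewrite card_eq_le => /andP[leM _]; exists M.
Qed.
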